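(* Let $R\in(0,\infty)$. The space $\mathcal{D}([0,R])$ of real-valued càdlàg functions on $[0,R]$, equipped with the metric $d_R$, has the input-EDAP.
   Context: A function $f:[0,R]\to\mathbb{R}$ is càdlàg if it is right-continuous and all left limits exist in $\mathbb{R}$. Let $\Lambda_R$ be the set of all strictly increasing, continuous $\lambda:[0,R]\to[0,R]$ with $\lambda(0)=0$ and $\lambda(R)=R$. The (Skorohod) metric is $$d_R(f,g)=\inf_{\lambda\in\Lambda_R}\max\Big\{\sup_{t\in[0,R]}|t-\lambda(t)|,\ \sup_{t\in[0,R]}|f(t)-g(\lambda(t))|\Big\}.$$ Input-EDAP (for $\mathbb{K}\in\{\mathbb{R},\mathbb{C}\}$): a metric space $(\mathcal{X},\rho)$ has the input-EDAP if there are mappings $E_n:\mathcal{X}\to\mathbb{K}^{w(n)}$ (possibly discontinuous, $w(n)\in\mathbb{N}$) and $D_n:\overline{E_n(\mathcal{X})}\to\mathcal{X}$, $n\in\mathbb{N}$, such that: (i) there is $r:\mathbb{N}\to(0,\infty)$ such that for each compact $K\subseteq\mathcal{X}$ there is $N_K\in\mathbb{N}$ with $\sup_{f\in K}|E_n(f)|\le r(n)$ for all $n\ge N_K$; (ii) each $D_n$ is continuous; (iii) for every compact $K\subseteq\mathcal{X}$, $\sup_{f\in K}\rho(f,D_n(E_n(f)))\to0$ as $n\to\infty$. *)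

(* Defs.v *)
From HB Require Import structures.
From mathcomp Require Import all_boot all_order all_algebra complex.
From mathcomp Require Import all_classical all_reals all_analysis.
From mathcomp Require Import lra.

Set Implicit Arguments.
Unset Strict Implicit.
Unset Printing Implicit Defensive.

Import Order.TTheory GRing.Theory Num.Theory.
Import numFieldNormedType.Exports.

Local Open Scope classical_set_scope.
Local Open Scope ring_scope.

(* [Rcomplex R] is R[i] seen as a real vector space, normed by the modulus
   z |-> sqrt (Re z ^ 2 + Im z ^ 2) with values in R. *)
Section Rcomplex_normedModType.
Context (R : realType).

HB.instance Definition _ :=
  PseudoMetric.copy (Rcomplex R) (pseudoMetric_normed (Rcomplex R)).
HB.instance Definition _ := isPointed.Build (Rcomplex R) 0.
HB.instance Definition _ :=
  NormedZmod_PseudoMetric_eq.Build R (Rcomplex R) erefl.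

Let Rcomplex_normrZ (a : R) (x : Rcomplex R) : `|a *: x| = `|a| * `|x|.
Proof.
case: x => x y.
rewrite /Num.norm/= /Num.norm/= !exprMn -mulrDr sqrtrM ?sqr_ge0//.
by rewrite sqrtr_sqr.
Qed.

HB.instance Definition _ :=
  PseudoMetricNormedZmod_Lmodule_isNormedModule.Build R (Rcomplex R)
    Rcomplex_normrZ.

End Rcomplex_normedModType.

Lemma clamp_lipschitz (R : realFieldType) (c x y : R) : 0 <= c ->
  `|Num.max 0 (Num.min x c) - Num.max 0 (Num.min y c)| <= `|x - y|.
Proof.
move=> c0; rewrite ler_norml.
have := ler_norm (x - y); have := ler_norm (y - x); rewrite distrC.
by case: (leP x c) => ?; case: (leP y c) => ?;
  rewrite ?(max_r c0); case: (leP 0 x) => ?; case: (leP 0 y) => ? ? ?;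
  apply/andP; split; lra.
Qed.

Section Skorohod.
Context (R : realType) (T : {posnum R}).

Definition time : Type := set_type [set` `[0, T%:num]].

Implicit Types (s t u : time) (l : time -> time).

(* At t = T (resp. t = 0) the first (resp. second) filter contains the empty
   set, so that nothing is required there. *)
Definition cadlag (f : time -> R) : Prop := forall t,
  f @ within [set s | val t < val s] (nbhs t) --> f t /\
  cvg (f @ within [set s | val s < val t] (nbhs t)).

Record cadlag_fun : Type :=
  CadlagFun { cadlag_val :> time -> R ; cadlagP : cadlag cadlag_val }.

Implicit Types f g h : cadlag_fun.

Definition time_changes : set (time -> time) := [set l : time -> time |
  [/\ forall s t, val s < val t -> val (l s) < val (l t),
      continuous l,
      forall t, val t = 0 -> val (l t) = 0 &
      forall t, val t = T%:num -> val (l t) = T%:num]].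

(* The suprema are finite, see [cadlag_bounded]. *)
Definition skorohod_dist f g : R :=
  inf [set Num.max (sup [set `|val t - val (l t)| | t in [set: time]])
                   (sup [set `|f t - g (l t)| | t in [set: time]])
      | l in time_changes].

Lemma time_ge0 t : 0 <= val t.
Proof. by case: t => x /= /set_mem /=; rewrite in_itv/= => /andP[]. Qed.

Lemma time_le t : val t <= T%:num.
Proof. by case: t => x /= /set_mem /=; rewrite in_itv/= => /andP[]. Qed.

Definition to_time (x : R) : 0 <= x <= T%:num -> time.
Proof. by move=> xT; exists x; apply/mem_set => /=; rewrite in_itv. Defined.

Lemma to_timeK (x : R) (xT : 0 <= x <= T%:num) : val (to_time xT) = x.
Proof. by []. Qed.

Definition time0 : time.
Proof. by apply: (@to_time 0); rewrite lexx ltW. Defined.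

Definition time1 : time.
Proof. by apply: (@to_time T%:num); rewrite lexx ltW. Defined.

Lemma nbhs_timeP t (A : set time) : nbhs t A <->
  exists2 e : R, 0 < e & forall s, `|val s - val t| < e -> A s.
Proof.
split=> [/nbhs_ballP[e e0 eA]|[e e0 eA]].
  by exists e => // s st; apply: eA; rewrite -initial_ballE /= /ball/= distrC.
apply/nbhs_ballP; exists e => // s; rewrite -initial_ballE/= /ball/= distrC.
exact: eA.
Qed.

Lemma cadlag_rightP f t (e : R) : 0 < e -> exists2 d : R, 0 < d &
  forall s, val t <= val s -> val s < val t + d -> `|f s - f t| < e.
Proof.
move=> e0; have [+ _] := cadlagP f t.
move=> /cvgrPdist_lt /(_ _ e0); rewrite near_withinE => /nbhs_timeP[d d0 dP].
exists d => // s; rewrite le_eqVlt => /orP[/eqP/val_inj <- _|ts sd].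
  by rewrite subrr normr0.
by rewrite distrC dP// ger0_norm ?subr_ge0 ?(ltW ts)// ltrBlDl.
Qed.

Lemma cadlag_leftP f t : exists (d a : R), 0 < d /\
  forall s, val s < val t -> val t - d < val s -> `|f s - a| < 1.
Proof.
have [_ /cvg_ex[a]] := cadlagP f t.
move=> /cvgrPdist_lt /(_ _ ltr01); rewrite near_withinE.
move=> /nbhs_timeP[d d0 dP]; exists d, a; split => // s st sd.
by rewrite distrC dP// ltr0_norm ?subr_lt0// opprB ltrBlDl -ltrBlDr.
Qed.

Lemma cadlag_bounded f : exists M : R, forall t, `|f t| <= M.
Proof.
have /compact_near_coveringP nc := @segment_compact R 0 T%:num.
have := nc R (pinfty_nbhs R)
  (fun M x => forall t, val t = x -> `|f t| <= M) _.
move=> /(_ _) H; suff : \forall M \near +oo, `[0, T%:num]%classic `<=`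
    (fun x => forall t, val t = x -> `|f t| <= M).
  move=> /filter_ex[M MP]; exists M => t; apply: (MP (val t)) => //=.
  by rewrite in_itv/= time_ge0 time_le.
apply: H => x /=; rewrite in_itv/= => xT; pose t := to_time xT.
have [d d0 dP] := cadlag_rightP f t ltr01.
have [d' [a [d'0 d'P]]] := cadlag_leftP f t.
exists (ball x (Num.min d d'), [set M | `|f t| + `|a| + 1 < M]).
  split; first by apply: nbhsx_ballx; rewrite lt_min d0.
  by exists (`|f t| + `|a| + 1); split => //; rewrite num_real.
move=> [y M] [/= + /ltW HM] s sy.
rewrite /ball/= lt_min -sy => /andP[xd xd']; apply: le_trans HM.
have [ts|st] := leP (val t) (val s).
  have := dP s ts; rewrite -ltrBlDl.
  have -> : val s - val t < d.
    by apply: le_lt_trans xd; rewrite distrC ler_norm.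
  move=> /(_ isT)/ltW; have := ler_normD (f s - f t) (f t).
  by rewrite subrK; have := normr_ge0 a; lra.
have := d'P s st; rewrite ltrBlDr -ltrBlDl.
have -> : val t - val s < d' by apply: le_lt_trans xd'; rewrite ler_norm.
move=> /(_ isT)/ltW; have := ler_normD (f s - a) a.
by rewrite subrK; have := normr_ge0 (f t); lra.
Qed.

Lemma time_incr_surj_continuous l :
  (forall s t, val s < val t -> val (l s) < val (l t)) ->
  (forall t, exists s, l s = t) -> continuous l.
Proof.
move=> lmono lsurj t A /nbhs_timeP[e e0 eA]; apply/nbhs_timeP.
have lcancel s u : val (l s) < val (l u) -> val s < val u.
  move=> su; rewrite ltNge; apply/negP; rewrite le_eqVlt => /orP[/eqP|].
    by move=> /val_inj us; rewrite us ltxx in su.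
  by move=> /lmono; rewrite ltNge (ltW su).
have [d d0 dP] : exists2 d : R, 0 < d &
    forall s, val s < val t + d -> val (l s) < val (l t) + e.
  have [lt|] := ltP (val (l t) + e / 2) T%:num; last first.
    move=> le; exists 1 => // s _; have := time_le (l s); lra.
  have yT : 0 <= val (l t) + e / 2 <= T%:num.
    by rewrite (ltW lt) andbT addr_ge0// ?time_ge0// divr_ge0// ltW.
  have [u lu] := lsurj (to_time yT).
  have luE : val (l u) = val (l t) + e / 2 by rewrite lu.
  have tu : val t < val u by apply: lcancel; rewrite luE; move: e0; clear; lra.
  exists (val u - val t); first by rewrite subr_gt0.
  by move=> s; rewrite addrC subrK => /lmono; rewrite luE; move: e0; clear; lra.
have [d' d'0 d'P] : exists2 d : R, 0 < d &
    forall s, val t - d < val s -> val (l t) - e < val (l s).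
  have [lt|] := ltP 0 (val (l t) - e / 2); last first.
    move=> le; exists 1 => // s _; have := time_ge0 (l s); lra.
  have yT : 0 <= val (l t) - e / 2 <= T%:num.
    move: (time_le (l t)) e0 lt; clear => ? ? ?.
    by apply/andP; split; lra.
  have [u lu] := lsurj (to_time yT).
  have luE : val (l u) = val (l t) - e / 2 by rewrite lu.
  have tu : val u < val t by apply: lcancel; rewrite luE; move: e0; clear; lra.
  exists (val t - val u); first by rewrite subr_gt0.
  by move=> s; rewrite opprB addrC subrK => /lmono; rewrite luE; move: e0; clear; lra.
exists (Num.min d d'); first by rewrite lt_min d0.
move=> s; rewrite lt_min !ltr_norml => /andP[/andP[_ sd] /andP[sd' _]].
apply: eA; rewrite ltr_norml.
have h1 : val s < val t + d by rewrite -ltrBlDl.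
have h2 : val t - d' < val s by move: sd'; rewrite ltrBrDl.
by apply/andP; split; [rewrite ltrBrDl d'P|rewrite ltrBlDl dP].
Qed.

Lemma time_change_surj l : time_changes l -> forall t, exists s, l s = t.
Proof.
move=> [lmono lcont l0 lT] t.
have clampT x : 0 <= Num.max 0 (Num.min x T%:num) <= T%:num.
  by rewrite le_max lexx/= ge_max ge_min lexx orbT andbT ltW.
pose g x := val (l (to_time (clampT x))).
have g0 : g 0 = 0 by apply: l0; rewrite /= min_l ?maxxx// ltW.
have gT : g T%:num = T%:num by apply: lT; rewrite /= minxx max_r.
have gcont : continuous g.
  move=> x; apply/cvgrPdist_lt => e e0.
  have : nbhs (to_time (clampT x))
      (l @^-1` [set s | `|val s - g x| < e]).
    by apply: lcont; apply/nbhs_timeP; exists e.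
  move=> /nbhs_timeP[d d0 dP]; apply/nbhs_ballP; exists d => // y.
  rewrite /ball/= => xy; rewrite distrC; apply: dP => /=.
  apply: le_lt_trans xy; rewrite distrC.
  exact: clamp_lipschitz.
have [c _ gc] : exists2 c, c \in `[0, T%:num] & g c = val t.
  apply: IVT; first exact: ltW.
    exact: continuous_subspaceT.
  have T0 : 0 <= T%:num by exact: ltW.
  by rewrite g0 gT (min_l T0) (max_r T0); apply/andP; rewrite time_ge0 time_le.
by exists (to_time (clampT c)); apply: val_inj.
Qed.

Lemma time_change_inv l : time_changes l ->
  exists l', [/\ time_changes l', forall t, l (l' t) = t & forall t, l' (l t) = t].
Proof.
move=> lL; have /choice[l' ll'] := time_change_surj lL.
have [lmono lcont l0 lT] := lL.
have linj s t : l s = l t -> s = t.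
  move=> st; apply: val_inj; apply/eqP; rewrite eq_le !leNgt.
  by apply/andP; split; apply/negP => /lmono; rewrite st ltxx.
have l'l t : l' (l t) = t by apply: linj.
exists l'; split => //; split.
- move=> s t st; rewrite ltNge; apply/negP; rewrite le_eqVlt => /orP[/eqP|].
    by move=> /val_inj /(congr1 l); rewrite !ll' => ts; rewrite ts ltxx in st.
  by move=> /lmono; rewrite !ll' ltNge (ltW st).
- apply: time_incr_surj_continuous; last by move=> t; exists (l t).
  move=> s t st; rewrite ltNge; apply/negP; rewrite le_eqVlt => /orP[/eqP|].
    by move=> /val_inj /(congr1 l); rewrite !ll' => ts; rewrite ts ltxx in st.
  by move=> /lmono; rewrite !ll' ltNge (ltW st).
- move=> t t0; have -> : t = l time0 by apply: val_inj; rewrite l0.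
  by rewrite l'l.
- move=> t t0; have -> : t = l time1 by apply: val_inj; rewrite lT.
  by rewrite l'l.
Qed.

Lemma time_change_id : time_changes id.
Proof. by split => // t; exact: cvg_id. Qed.

Lemma time_change_comp l l' : time_changes l -> time_changes l' ->
  time_changes (l' \o l).
Proof.
move=> [m c z o] [m' c' z' o']; split => /=.
- by move=> s t /m/m'.
- by move=> t; apply: continuous_comp; [exact: c|exact: c'].
- by move=> t /z/z'.
- by move=> t /o/o'.
Qed.

Definition dist_along f g l : R :=
  Num.max (sup [set `|val t - val (l t)| | t in [set: time]])
          (sup [set `|f t - g (l t)| | t in [set: time]]).

Lemma has_sup_time l : has_sup [set `|val t - val (l t)| | t in [set: time]].
Proof.
split; first by exists `|val time0 - val (l time0)|, time0.
exists T%:num => _ [t _ <-]; rewrite ler_norml.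
have := time_ge0 t; have := time_ge0 (l t); have := time_le t.
by have := time_le (l t); move=> *; apply/andP; split; lra.
Qed.

Lemma has_sup_val f g l : has_sup [set `|f t - g (l t)| | t in [set: time]].
Proof.
split; first by exists `|f time0 - g (l time0)|, time0.
have [M MP] := cadlag_bounded f; have [N NP] := cadlag_bounded g.
exists (M + N) => _ [t _ <-].
by rewrite (le_trans (ler_normB _ _))// lerD.
Qed.

Lemma dist_along_time f g l t : `|val t - val (l t)| <= dist_along f g l.
Proof.
rewrite le_max; apply/orP; left.
by apply: sup_upper_bound; [exact: has_sup_time|exists t].
Qed.

Lemma dist_along_val f g l t : `|f t - g (l t)| <= dist_along f g l.
Proof.
rewrite le_max; apply/orP; right.
by apply: sup_upper_bound; [exact: has_sup_val|exists t].
Qed.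

Lemma dist_along_le f g l (e : R) :
  (forall t, `|val t - val (l t)| <= e) -> (forall t, `|f t - g (l t)| <= e) ->
  dist_along f g l <= e.
Proof.
move=> h1 h2; rewrite ge_max; apply/andP; split; apply: ge_sup.
- by have [] := has_sup_time l.
- by move=> _ [t _ <-].
- by have [] := has_sup_val f g l.
- by move=> _ [t _ <-].
Qed.

Lemma dist_le f g l : time_changes l -> skorohod_dist f g <= dist_along f g l.
Proof.
move=> lL; apply: ge_inf; last by exists l.
exists 0 => _ [l' _ <-]; apply: le_trans (dist_along_time f g l' time0).
exact: normr_ge0.
Qed.

Lemma dist_lt f g (e : R) : skorohod_dist f g < e ->
  exists2 l, time_changes l & dist_along f g l < e.
Proof.
move=> /inf_lt[].
  by exists (dist_along f g id), id => //; exact: time_change_id.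
by move=> _ [l lL <-] le; exists l.
Qed.

Lemma skorohod_dist_ge0 f g : 0 <= skorohod_dist f g.
Proof.
apply: lb_le_inf.
  by exists (dist_along f g id), id => //; exact: time_change_id.
move=> _ [l' _ <-]; apply: le_trans (dist_along_time f g l' time0).
exact: normr_ge0.
Qed.

Lemma skorohod_distxx f : skorohod_dist f f = 0.
Proof.
apply/eqP; rewrite eq_le skorohod_dist_ge0 andbT.
apply: le_trans (dist_le _ _ time_change_id) _.
by apply: dist_along_le => t; rewrite subrr normr0.
Qed.

Lemma dist_approx f g (e : R) : 0 < e ->
  exists2 l, time_changes l & dist_along f g l < skorohod_dist f g + e.
Proof. by move=> e0; apply: dist_lt; rewrite ltrDl. Qed.

Lemma skorohod_dist_sym_le f g : skorohod_dist g f <= skorohod_dist f g.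
Proof.
apply/ler_addgt0Pr => e e0.
have [l lL /ltW le] := dist_approx f g e0.
have [l' [l'L ll' l'l]] := time_change_inv lL.
apply: le_trans (dist_le _ _ l'L) (le_trans _ le).
apply: dist_along_le => t; rewrite distrC.
- by rewrite -{2}(ll' t); exact: dist_along_time.
- by rewrite -{2}(ll' t); exact: dist_along_val.
Qed.

Lemma skorohod_dist_sym f g : skorohod_dist f g = skorohod_dist g f.
Proof. by apply/eqP; rewrite eq_le !skorohod_dist_sym_le. Qed.

Lemma skorohod_dist_triangle g f h :
  skorohod_dist f h <= skorohod_dist f g + skorohod_dist g h.
Proof.
apply/ler_addgt0Pr => e e0; have e2 : 0 < e / 2 by rewrite divr_gt0.
have [l lL le] := dist_approx f g e2.
have [l' l'L le'] := dist_approx g h e2.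
apply: le_trans (dist_le _ _ (time_change_comp lL l'L)) _.
apply: (@le_trans _ _ (dist_along f g l + dist_along g h l')); last by lra.
apply: dist_along_le => t /=.
- apply: le_trans (ler_distD (val (l t)) _ _) _.
  by rewrite lerD ?dist_along_time.
- apply: le_trans (ler_distD (g (l t)) _ _) _.
  by rewrite lerD ?dist_along_val.
Qed.

Lemma skorohod_dist_eq0 f g : skorohod_dist f g = 0 -> f = g.
Proof.
move=> fg0.
suff fg t : f t = g t.
  case: f g fg {fg0} => [f fP] [g gP] /= fg.
  have E : f = g by apply/funext.
  by case: _ / E gP => gP; congr CadlagFun; exact: Prop_irrelevance.
apply/eqP; rewrite -subr_eq0 -normr_le0; apply/ler_addgt0Pr => e e0.
rewrite add0r; have e3 : 0 < e / 3 by rewrite divr_gt0.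
have [tT|] := ltP (val t) T%:num; last first.
  move=> Tt; have tE : val t = T%:num.
    by apply/eqP; rewrite eq_le Tt time_le.
  have [l [_ _ _ lT]] := dist_approx f g e0; rewrite fg0 add0r => le.
  have lt : l t = t by apply: val_inj; rewrite lT.
  by have := dist_along_val f g l t; rewrite lt; lra.
have [d d0 dP] := cadlag_rightP f t e3.
have [d' d'0 d'P] := cadlag_rightP g t e3.
have [m m0 [md md' mT]] : exists2 m : R, 0 < m &
    [/\ m <= d, m <= d' & m <= T%:num - val t].
  exists (Num.min (Num.min d d') (T%:num - val t)).
    by rewrite !lt_min d0 d'0 subr_gt0.
  by rewrite !ge_min !lexx !orbT.
have sT : 0 <= val t + m / 2 <= T%:num.
  move: mT m0 (time_ge0 t); clear.
  by move=> ? ? ?; apply/andP; split; lra.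
pose s := to_time sT; have sE : val s = val t + m / 2 by [].
have em : 0 < Num.min (e / 3) (m / 2) by rewrite lt_min e3 divr_gt0.
have [l lL] := dist_approx f g em; rewrite fg0 add0r lt_min => /andP[le lm].
have := dist_along_time f g l s.
have fs := le_lt_trans (dist_along_val f g l s) le.
move=> /le_lt_trans /(_ lm); rewrite ltr_norml sE => /andP[l1 l2].
have ft : `|f s - f t| < e / 3.
  by apply: dP; rewrite sE; [move: m0|move: m0 md]; clear; lra.
have gt : `|g (l s) - g t| < e / 3.
  by apply: d'P; [move: l2|move: l1 md']; clear; lra.
apply: le_trans (ler_distD (f s) _ _) _; rewrite distrC.
have := ler_distD (g (l s)) (f s) (g t).
by move: fs ft gt; clear; lra.
Qed.

HB.instance Definition _ := gen_eqMixin cadlag_fun.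
HB.instance Definition _ := gen_choiceMixin cadlag_fun.
HB.instance Definition _ := isMetric.Build R cadlag_fun
  skorohod_distxx skorohod_dist_eq0 skorohod_dist_sym skorohod_dist_triangle.

End Skorohod.

Section EDAP.
Context (R : realType) (K : normedModType R) (X : metricType R).

Definition euclidean_norm (n : nat) (v : 'rV[K]_n) : R :=
  Num.sqrt (\sum_(i < n) `|v 0 i| ^+ 2).

(* The supremum is taken in [0, +oo], so that it is 0 over the empty set. *)
Definition sup_over (C : set X) (g : X -> R) : \bar R :=
  ereal_sup (0%E |` [set (g x)%:E | x in C]).

Definition in_closure_range (Y : topologicalType) (E : X -> Y) (x : X) :
    closure (range E) :=
  exist _ (E x) (mem_set (subset_closure (imageT E x))).

(* [K] is meant to be the field of real or of complex numbers. *)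
Definition input_EDAP : Prop :=
  exists (w : nat -> nat) (E : forall n, X -> 'rV[K]_(w n))
         (D : forall n, closure (range (E n)) -> X),
  [/\ forall n, (0 < w n)%N,
      exists2 r : nat -> R, (forall n, 0 < r n) &
        forall C : set X, compact C -> exists N : nat, forall n, (N <= n)%N ->
          (sup_over C (fun x => euclidean_norm (E n x)) <= (r n)%:E)%E,
      forall n, continuous (D n) &
      forall C : set X, compact C ->
        sup_over C (fun x => mdist x (D n (in_closure_range (E n) x)))
          @[n --> \oo] --> 0%E].

End EDAP.

(* Main.v *)
Require Import Defs.
From HB Require Import structures.
From mathcomp Require Import all_boot all_order all_algebra complex.
From mathcomp Require Import all_classical all_reals all_analysis.
From mathcomp Require Import lra.

Set Implicit Arguments.
Unset Strict Implicit.
Unset Printing Implicit Defensive.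

Import Order.TTheory GRing.Theory Num.Theory.
Import numFieldNormedType.Exports.

Local Open Scope classical_set_scope.
Local Open Scope ring_scope.

(** Every separable metric space has the input-EDAP: if (u_k) is dense, let E_n(x)
    be the index of a point of u_0, ..., u_n nearest to x, and let D_n map this
    index back to the point. E_n has finite range, so D_n is continuous, and E_n
    is bounded by n. On a compact set the error tends to 0 because the set is
    covered by finitely many balls centred at the u_k.

    The Skorohod space is separable: a càdlàg function is uniformly close to a
    step function, and a time change close to the identity moves the breakpoints
    of the latter to rational multiples of T. *)

(** * Discreteness of finite subsets of accessible spaces *)

Lemma matrix_accessible (K : topologicalType) (m n : nat) :
  accessible_space K -> accessible_space 'M[K]_(m, n).
Proof.
move=> aK x y xy.
have [i [j xyij]] : exists i j, x i j != y i j.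
  apply: contrapT => h; move/eqP: xy; apply; apply/matrixP => i j.
  by apply/eqP; apply: contrapT => /negP ij; apply: h; exists i, j.
have [A [oA xA yA]] := aK _ _ xyij.
exists [set M : 'M[K]_(m, n) | A (M i j)]; split.
- rewrite openE => M AM; exists (fun i' j' => [set z | i' = i -> j' = j -> A z]).
    move=> i' j'; have [->|ii'] := eqVneq i' i; have [->|jj'] := eqVneq j' j;
      apply: filterS (open_nbhs_nbhs (conj oA AM)) || apply: filterS filterT;
      by [move=> z Az _ _ |move=> z _ // /eqP; rewrite (negPf ii')
         |move=> z _ // _ /eqP; rewrite (negPf jj')].
  by move=> N /(_ i j); apply.
- by move: xA; rewrite !inE.
- by move: yA; rewrite !inE.
Qed.

(** Removing [val y] from the finite set [A] leaves a closed set, so every point of [A] is isolated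
    and any [D] is continuous. *)
Lemma finite_accessible_continuous (Y X : topologicalType) (A : set Y)
    (D : A -> X) : accessible_space Y -> finite_set A -> continuous D.
Proof.
move=> aY fA y B /= DyB.
have cA : closed (A `\ val y).
  exact: (accessible_finite_set_closed.1 aY _ (finite_setD _ fA)).
have : nbhs y ((val : A -> Y) @^-1` (~` (A `\ val y))).
  apply: (@initial_continuous A Y val y).
  by apply: open_nbhs_nbhs; split; [exact: closed_openC|move=> [_]; exact].
apply: filterS => z /= zy; suff -> : z = y by exact: nbhs_singleton.
apply: val_inj; apply: contrapT => zyn; apply: zy; split => //.
exact: set_valP.
Qed.

(** * Encoding and decoding in a separable metric space *)

Section separable_EDAP.
Context (R : realType) (K : normedModType R) (X : metricType R).

Lemma cvg0_sup_over (C : set X) (g : nat -> X -> R) :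
  (forall e, 0 < e -> \forall n \near \oo, forall x, C x -> g n x <= e) ->
  sup_over C (g n) @[n --> \oo] --> 0%E.
Proof.
move=> gle A; rewrite [nbhs 0%E A]nbhs_EFin => /nbhs_ballP[e /= e0 eA].
have e2 : 0 < e / 2 by rewrite divr_gt0.
apply: filterS (gle _ e2) => n nP /=.
have s0 : (0 <= sup_over C (g n))%E by apply: ereal_sup_ubound; left.
have se : (sup_over C (g n) <= (e / 2)%:E)%E.
  apply: ge_ereal_sup => _ [->|[x Cx <-]]; first by rewrite lee_fin ltW.
  by rewrite lee_fin nP.
(* Between [0] and [e / 2] the extended supremum is finite. *)
case: sup_over s0 se => //= s; rewrite !lee_fin => s0 se.
apply: eA; rewrite /ball/= sub0r normrN ger0_norm//.
by apply: le_lt_trans se _; rewrite ltr_pdivrMr// ltr_pMr// ltr1n.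
Qed.

Lemma separable_input_EDAP (u : nat -> X) (v : K) : v != 0 ->
  (forall x (e : R), 0 < e -> exists k, mdist x (u k) < e) ->
  input_EDAP K X.
Proof.
move=> v0 udense.
pose k n x : 'I_n.+1 := [arg min_(i < ord0) mdist x (u i)]%O.
have kP n x i : (i <= n)%N -> mdist x (u (k n x)) <= mdist x (u i).
  rewrite -ltnS => ni; rewrite /k; case: arg_minP => // j _ /(_ (Ordinal ni)).
  exact.
(* The index becomes a multiple of [v], injectively as [v] is nonzero; this treats real and complex
   scalars alike. *)
pose E n x : 'rV[K]_1 := \row__ ((k n x)%:R *: v).
have Einj n x y : E n x = E n y -> k n x = k n y.
  move=> /matrixP /(_ ord0 ord0); rewrite !mxE => /eqP.
  rewrite -subr_eq0 -scalerBl scaler_eq0 (negPf v0) orbF subr_eq0 eqr_nat.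
  by move=> /eqP/val_inj.
have fE n : finite_set (range (E n)).
  apply: (@sub_finite_set _ _
    (range (fun i : 'I_n.+1 => \row__ (i%:R *: v) : 'rV[K]_1))).
    by move=> _ [x _ <-]; exists (k n x).
  exact/finite_image/finite_finset.
have aK : accessible_space 'rV[K]_1.
  exact/matrix_accessible/hausdorff_accessible/norm_hausdorff.
(* Any preimage of [y] will do, since the code determines the index; [u 0] is the default of
   [xget]. *)
pose D n (y : closure (range (E n))) : X :=
  u (k n (xget (u 0) [set x | E n x = val y])).
have DE n x : D n (in_closure_range (E n) x) = u (k n x).
  congr u; congr nat_of_ord; apply: Einj.
  by apply: (@xgetPex _ _ [set z | E n z = E n x]); exists x.
exists (fun=> 1), E, D; split => //.
- exists (fun n => n%:R * `|v| + 1).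
    by move=> n; rewrite ltr_wpDl// mulr_ge0.
  move=> C _; exists 0 => n _.
  apply: ge_ereal_sup => _ [->|[x Cx <-]]; rewrite lee_fin.
    by rewrite addr_ge0// mulr_ge0.
  rewrite /euclidean_norm big_ord_recl big_ord0 addr0 sqrtr_sqr normr_id mxE.
  rewrite normrZ normr_nat (@le_trans _ _ (n%:R * `|v|)) ?lerDl//.
  by rewrite ler_wpM2r// ler_nat -ltnS.
- move=> n; apply: finite_accessible_continuous => //.
  by rewrite -(closure_id _).1//; apply: (accessible_finite_set_closed.1 aK).
- move=> C /compact_near_coveringP Ccov; apply: cvg0_sup_over => e e0.
  (* It remains to find, for each [x], a neighbourhood and a threshold on [n]: some [u i] is
     [e]-close to all points near [x], and is a candidate once [i <= n]. *)
  apply: (Ccov nat \oo (fun n x =>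
    mdist x (D n (in_closure_range (E n) x)) <= e)) => x Cx.
  have [i xi] := udense x e e0.
  exists ([set y | mdist y (u i) < e], [set n | (i <= n)%N]) => /=.
    split; last by exists i.
    have : nbhs x (ball x (e - mdist x (u i))).
      by apply: nbhsx_ballx; rewrite subr_gt0.
    apply: filterS => y; rewrite ballEmdist /= ltrBrDr metric_sym.
    by apply: le_lt_trans; exact: metric_triangle.
  by move=> [y n] /= [yi ni]; rewrite DE (le_trans (kP n y i ni))// ltW.
Qed.

End separable_EDAP.

(** * Elementary real estimates and tent functions *)

Lemma ler_norm_sum_seq (R : numDomainType) (I : Type) (s : seq I) (F : I -> R)
    (c : R) : (forall i, `|F i| <= c) -> `|\sum_(i <- s) F i| <= c *+ size s.
Proof.
move=> Fc; elim: s => [|i s IH]; first by rewrite big_nil normr0.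
by rewrite big_cons /= mulrS (le_trans (ler_normD _ _))// lerD.
Qed.

(** The smallest distance between distinct points, capped at [1], which also covers lists without
    distinct points. *)
Lemma seq_separated (R : realFieldType) (s : seq R) : exists2 r : R, 0 < r &
  {in s &, forall x y, x != y -> r <= `|x - y|}.
Proof.
pose r := \big[Num.min/1]_(x <- s) \big[Num.min/1]_(y <- s | x != y) `|x - y|.
exists r.
  apply: (big_ind (fun x => 0 < x)) => // [x y x0 y0|x _]; first by rewrite lt_min x0.
  apply: (big_ind (fun x => 0 < x)) => // [y z y0 z0|y xy]; first by rewrite lt_min y0.
  by rewrite normr_gt0 subr_eq0.
move=> x y xs ys xy; apply: (@bigmin_inf_seq _ _ _ s _ x) => //.
exact: (@ge_bigmin_seq _ _ _ s _ y).
Qed.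

Lemma ratr_mul_approx (R : realType) (k x e : R) : 0 < k -> 0 < e ->
  exists r : rat, `|k * ratr r - x| <= e.
Proof.
move=> k0 e0.
have [r] : exists r : rat, ratr r \in `]x / k, (x + e) / k[.
  by apply: rat_in_itvoo; rewrite ltr_pM2r ?invr_gt0// ltrDl.
rewrite in_itv/= ltr_pdivrMr// ltr_pdivlMr// mulrC => /andP[h1 h2].
by exists r; rewrite ler_norml; apply/andP; split; lra.
Qed.

Definition tent (R : realDomainType) (r p x : R) : R := Num.max 0 (r - `|x - p|).

Lemma tent_lipschitz (R : realFieldType) (r p x y : R) :
  `|tent r p x - tent r p y| <= `|x - y|.
Proof.
rewrite /tent; have := ler_distD y x p; have := ler_distD x y p.
rewrite (distrC y x) => h1 h2; rewrite ler_norml.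
by case: (leP 0 (r - `|x - p|)) => ?; case: (leP 0 (r - `|y - p|)) => ?;
  apply/andP; split; lra.
Qed.

Lemma tent_norm_le (R : realFieldType) (r p x : R) : 0 < r -> `|tent r p x| <= r.
Proof.
move=> r0; rewrite ger0_norm ?le_max ?lexx//.
by rewrite ge_max (ltW r0) gerBl normr_ge0.
Qed.

(** * Time changes and step functions *)

Section skorohod_separable.
Context (R : realType) (T : {posnum R}).
Implicit Types (t : time T) (c : seq (R * R)).

(** An increasing map fixing both endpoints preserves the interval, and the Lipschitz bound supplies
    continuity. *)
Lemma time_change_of_homeo (g : R -> R) (k : R) : {mono g : x y / x <= y} ->
  (forall x y, `|g x - g y| <= k * `|x - y|) -> g 0 = 0 -> g T%:num = T%:num ->
  exists2 l : time T -> time T, time_changes l &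
    forall t, val (l t) = g (val t).
Proof.
move=> gmono glip g0 gT.
have gP (t : time T) : 0 <= g (val t) <= T%:num.
  apply/andP; split; [rewrite -[leLHS]g0|rewrite -[leRHS]gT].
    by rewrite gmono time_ge0.
  by rewrite gmono time_le.
exists (fun t => to_time (gP t)) => //; split => /=.
- by move=> s t; rewrite (leW_mono gmono).
- move=> t A /nbhs_timeP[e e0 eA]; apply/nbhs_timeP.
  have k0 : 0 <= k.
    by have := glip 1 0; rewrite subr0 normr1 mulr1; exact: le_trans.
  exists (e / (k + 1)); first by rewrite divr_gt0// ltr_wpDl.
  move=> s; rewrite ltr_pdivlMr ?ltr_wpDl// => st; apply: eA => /=.
  apply: le_lt_trans (glip _ _) (le_lt_trans _ st).
  by rewrite mulrC ler_wpM2l// lerDl.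
- by move=> t ->.
- by move=> t ->.
Qed.

(* [g x = x + sum_p (sigma p - p) tent_p x / r] with [r] a separation radius of
   [s]; for [sigma] close to the identity, the correction has Lipschitz constant
   at most 1/2, so [g] is increasing. *)
Lemma interpolating_homeo (s : seq R) (e : R) : 0 < e ->
  exists2 eta : R, 0 < eta & forall sigma : R -> R,
    (forall p, `|sigma p - p| <= eta) ->
    exists g : R -> R, [/\ {mono g : x y / x <= y},
      forall x y, `|g x - g y| <= 2 * `|x - y|,
      forall x, `|g x - x| <= e &
      {in s, forall p, g p = sigma p}].
Proof.
move=> e0; have [r r0 rP] := seq_separated s.
pose m : R := (size s)%:R + 1.
have m0 : 0 < m by rewrite ltr_wpDl.
(* The first bound makes the correction 1/2-Lipschitz, the second keeps it below [e]; [m] bounds the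
   number of tents. *)
pose kap := Num.min (2^-1 / m) (e / (r * m)).
have kap0 : 0 < kap by rewrite lt_min !divr_gt0 ?mulr_gt0 ?invr_gt0.
have kapm : kap * m <= 2^-1 by rewrite -ler_pdivlMr// ge_min lexx.
have kaprm : kap * r * m <= e.
  by rewrite -mulrA -ler_pdivlMr ?mulr_gt0// ge_min lexx orbT.
have lem (c x : R) : 0 <= c -> x <= c *+ size (undup s) -> x <= c * m.
  move=> c0 /le_trans; apply; rewrite -mulr_natr ler_wpM2l//.
  by rewrite ler_wpDr// ler_nat size_undup.
exists (kap * r); first exact: mulr_gt0.
move=> sigma sigmaP; pose d p := (sigma p - p) / r.
have dP p : `|d p| <= kap.
  by rewrite normrM normfV (gtr0_norm r0) ler_pdivrMr.
pose phi x := \sum_(p <- undup s) d p * tent r p x.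
have phiL x y : `|phi x - phi y| <= 2^-1 * `|x - y|.
  rewrite -sumrB; apply: (@le_trans _ _ (kap * `|x - y| * m)); last first.
    by rewrite mulrAC ler_wpM2r.
  apply: lem; first by rewrite mulr_ge0// ltW.
  apply: ler_norm_sum_seq => p.
  by rewrite -mulrBr normrM ler_pM// tent_lipschitz.
have phie x : `|phi x| <= e.
  apply: le_trans kaprm; apply: lem; first by rewrite mulr_ge0// ltW.
  apply: ler_norm_sum_seq => p.
  by rewrite normrM ler_pM// tent_norm_le.
(* Other points of [s] are at distance at least [r] from [p], so at [p] only its own tent survives,
   with value [r]. *)
have phip : {in s, forall p, phi p = sigma p - p}.
  move=> p ps; rewrite /phi (bigD1_seq p) ?mem_undup ?undup_uniq//=.
  rewrite {1}/tent subrr normr0 subr0 max_r ?ltW// /d divfK ?gt_eqF//.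
  rewrite big_seq_cond big1 ?addr0// => q /andP[]; rewrite mem_undup => qs qp.
  rewrite /tent max_l ?mulr0// subr_le0 distrC.
  by rewrite rP.
have glt x y : x < y -> x + phi x < y + phi y.
  move=> xy; have := phiL y x; rewrite (gtr0_norm (_ : 0 < y - x)) ?subr_gt0//.
  by rewrite ler_norml => /andP[+ _]; move: xy; clear; lra.
exists (fun x => x + phi x); split.
- exact: le_mono.
- move=> x y; rewrite opprD addrACA (le_trans (ler_normD _ _))//.
  by have := phiL x y; have := normr_ge0 (x - y); lra.
- by move=> x; rewrite addrAC subrr add0r.
- by move=> p ps; rewrite phip// addrC subrK.
Qed.

(** The list is searched from its head, so later breakpoints are meant to come first; no ordering is
    imposed, which keeps inductions free of side conditions. *)
Fixpoint step c (t : time T) : R :=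
  if c is (p, q) :: c' then if p <= val t then q else step c' t else 0.

(** The closed test [p <= val t] gives right-continuity at [p]; to the left of [p] the function is
    the tail. *)
Lemma cadlag_step c : cadlag (step c).
Proof.
elim: c => [|[p q] c IH] t /=.
  by split; [exact: cvg_cst|exact: is_cvg_cst].
have [ct /cvg_ex[b lt]] := IH t.
have near_val (A : set R) (B : set (time T)) : open A -> A (val t) ->
    \forall s \near within B (nbhs t), A (val s).
  move=> oA At; rewrite near_withinE.
  have : nbhs t ((val : time T -> R) @^-1` A).
    apply: (@initial_continuous (time T) R val t).
    exact: open_nbhs_nbhs.
  by apply: filterS => s As _.
have cvgE (B : set (time T)) (f g : time T -> R) (l : R) :
    (\forall s \near within B (nbhs t), f s = g s) ->
    f @ within B (nbhs t) --> l -> g @ within B (nbhs t) --> l.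
  by move=> fg; apply: cvg_trans; exact: near_eq_cvg.
have [pt|tp] := leP p (val t).
  split.
    apply: (cvgE _ (cst q)); last exact: cvg_cst.
    rewrite near_withinE; apply: nearW => s /= ts.
    by rewrite (le_trans pt (ltW ts)).
  move: pt; rewrite le_eqVlt => /orP[/eqP pt|pt]; apply/cvg_ex.
    exists b; apply: cvgE lt; rewrite near_withinE; apply: nearW => s /= ts.
    by rewrite leNgt pt ts.
  exists q; apply: (cvgE _ (cst q)); last exact: cvg_cst.
  have := near_val [set x | p < x] [set s | val s < val t] (@open_gt _ p) pt.
  by apply: filterS => s /= /ltW ->.
have E B : \forall s \near within B (nbhs t),
    step c s = if p <= val s then q else step c s.
  have := near_val [set x | x < p] B (@open_lt _ p) tp.
  by apply: filterS => s /=; rewrite ltNge => /negPf ->.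
split; first exact: cvgE ct.
by apply/cvg_ex; exists b; exact: cvgE lt.
Qed.

Definition cadlag_step_fun c : cadlag_fun T := CadlagFun (@cadlag_step c).

Lemma cadlag_left_lt (f : cadlag_fun T) t (e : R) : 0 < e -> exists (d a : R),
  0 < d /\ forall s, val s < val t -> val t - d < val s -> `|f s - a| < e.
Proof.
move=> e0; have [_ /cvg_ex[a]] := cadlagP f t.
move=> /cvgrPdist_lt /(_ _ e0); rewrite near_withinE.
move=> /nbhs_timeP[d d0 dP]; exists d, a; split => // s st sd.
by rewrite distrC dP// ltr0_norm ?subr_lt0// opprB ltrBlDl -ltrBlDr.
Qed.

(** Supremum argument: were approximation possible only on some intervals [[0, a[] with [a] at most
    [T], right-continuity and the left limit at the supremum would push past it. *)
Lemma step_approx (f : cadlag_fun T) (e : R) : 0 < e ->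
  exists c, forall t, `|f t - step c t| <= e.
Proof.
move=> e0.
pose A := [set a : R | exists c, forall t, val t < a -> `|f t - step c t| <= e].
have [[a [c ca] Ta]|AT] := pselect (exists2 a, A a & T%:num < a).
  by exists c => t; rewrite ca// (le_lt_trans (time_le t)).
have A0 : A 0.
  by exists [::] => t; rewrite ltNge time_ge0.
have ubA : ubound A T%:num.
  by move=> a Aa; rewrite leNgt; apply/negP => Ta; apply: AT; exists a.
have supA : has_sup A by split; [exists 0|exists T%:num].
have aT : 0 <= sup A <= T%:num.
  by rewrite (ub_le_sup _ A0)//= ?ge_sup//; [exists 0|exists T%:num].
pose t := to_time aT; have tE : val t = sup A by [].
have [d' [b [d'0 bP]]] := cadlag_left_lt f t e0.
have [a [c ca] ta] := sup_adherent d'0 supA.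
have [d d0 dP] := cadlag_rightP f t e0.
suff /(ub_le_sup (proj2 supA)) : A (sup A + d) by rewrite gerDl leNgt d0.
(* Value [f t] from [sup A] on, [b] on [[a, sup A[], and the old list before [a]. *)
exists ((sup A, f t) :: (a, b) :: c) => s /= sd.
have [ts|st] := leP (sup A) (val s); first by rewrite ltW// dP.
have [as_|sa] := leP a (val s); last exact: ca.
by rewrite ltW// bP// tE (lt_le_trans ta).
Qed.

(** As [g] is increasing, both searches stop at the same position of the list, and only the values
    there differ. *)
Lemma step_perturb (c : seq (R * R)) (e : R) (g sigma tau : R -> R)
    (l : time T -> time T) :
  {mono g : x y / x <= y} -> (forall t, val (l t) = g (val t)) ->
  {in map fst c, forall p, g p = sigma p} -> (forall q, `|q - tau q| <= e) ->
  forall t, `|step c t - step [seq (sigma pq.1, tau pq.2) | pq <- c] (l t)| <= e.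
Proof.
move=> gmono lE + tauP t; elim: c => [|[p q] c IH] /= gs.
  (* Both sides are the default [0]; [tauP 0] provides [0 <= e]. *)
  by rewrite subrr normr0 (le_trans _ (tauP 0)).
rewrite -gs ?mem_head// lE gmono; case: (leP p (val t)) => // _.
by apply: IH => x xc; rewrite gs// inE xc orbT.
Qed.

Lemma cadlag_fun_separable : exists u : nat -> cadlag_fun T,
  forall f (e : R), 0 < e -> exists k, mdist f (u k) < e.
Proof.
pose rat_step (c : seq (rat * rat)) :=
  cadlag_step_fun [seq (T%:num * ratr pq.1, ratr pq.2) | pq <- c].
exists (fun n => rat_step (odflt [::] (unpickle n))) => f e e0.
have e4 : 0 < e / 4 by rewrite divr_gt0.
have [c fc] := step_approx f e4.
(* The endpoints join the breakpoints, and [sigma] is chosen exact there, so that the homeomorphism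
   fixes them. *)
have [eta eta0 homeo] :=
  interpolating_homeo (0 :: T%:num :: map fst c) e4.
have /choice[sigma sigmaP] p : exists r : rat, [/\ `|T%:num * ratr r - p| <= eta,
    p = 0 -> T%:num * ratr r = 0 & p = T%:num -> T%:num * ratr r = T%:num].
  have [->|p0] := eqVneq p 0.
    by exists 0; rewrite raddf0 mulr0 subrr normr0 ltW.
  have [->|pT] := eqVneq p T%:num.
    by exists 1; rewrite rmorph1 mulr1 subrr normr0 ltW.
  have [r rp] := ratr_mul_approx p (gt0 T) eta0.
  by exists r; split=> // /eqP; rewrite ?(negPf p0) ?(negPf pT).
have /choice[tau tauP] q : exists r : rat, `|q - ratr r| <= e / 4.
  have [r] := ratr_mul_approx q ltr01 e4.
  by rewrite mul1r distrC; exists r.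
have [|g [gmono glip ge gs]] := homeo (fun p => T%:num * ratr (sigma p)).
  by move=> p; have [] := sigmaP p.
have g0 : g 0 = 0 by rewrite gs ?mem_head//; have [_ ->] := sigmaP 0.
have gT : g T%:num = T%:num.
  by rewrite gs ?inE ?eqxx ?orbT//; have [_ _ ->] := sigmaP T%:num.
have [l lL lE] := time_change_of_homeo gmono glip g0 gT.
exists (pickle [seq (sigma pq.1, tau pq.2) | pq <- c]).
(* The value error is twice [e / 4], once for [c] and once for rounding; [e / 2] leaves room for
   strictness. *)
rewrite pickleK /=; apply: (@le_lt_trans _ _ (e / 2)); last by lra.
apply: le_trans (dist_le _ _ lL) _; apply: dist_along_le => t.
  by rewrite lE distrC (le_trans (ge _))//; lra.
rewrite /= -map_comp; apply: le_trans (ler_distD (step c t) _ _) _.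
have -> : e / 2 = e / 4 + e / 4 by lra.
rewrite lerD//; apply: (step_perturb (sigma := fun p => T%:num * ratr (sigma p))
  (tau := fun q => ratr (tau q)) gmono lE) => //.
by move=> p pc; rewrite gs// !inE pc !orbT.
Qed.

End skorohod_separable.

Theorem theorem3p50 (R : realType) (T : {posnum R}) :
  input_EDAP R^o (cadlag_fun T) /\ input_EDAP (Rcomplex R) (cadlag_fun T).
Proof.
have [u uP] := cadlag_fun_separable T.
split.
  exact: (@separable_input_EDAP R R^o _ u 1 (oner_neq0 R) uP).
exact: (@separable_input_EDAP R (Rcomplex R) _ u 1 (oner_neq0 R[i]) uP).
Qed.
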